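(* In the axiom system $\mathtt{TMM}\setminus\{\mathtt{spec},\mathtt{ALLeq}\}$, the scheme $\mathtt{ALLcomm}$ cannot be weakened by adding the disjoint variable condition $\mathrm{DV}(x,y)$ or $\mathrm{DV}(y,\phi)$: for each $D\in\{\{x,y\},\{y,\phi\}\}$, the scheme $\mathtt{ALLcomm}$ (i.e. $\forall x\forall y\,\phi\to\forall y\forall x\,\phi$ without disjoint variable conditions) is not provable from the set of schemes consisting of $\mathtt{TMM}\setminus\{\mathtt{spec},\mathtt{ALLeq},\mathtt{ALLcomm}\}$ together with the scheme $(\forall x\forall y\,\phi\to\forall y\forall x\,\phi,\ \{D\})$. In particular, $\mathtt{ALLcomm}$ is independent in $\mathtt{TMM}\setminus\{\mathtt{spec},\mathtt{ALLeq}\}$.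
   Context: **Metavariables and metaformulas.** Let $\mathrm{vrMV}=\{x_i\mid i\in\omega\}$ (variable metavariables) and $\mathrm{fmMV}=\{\phi_i\mid i\in\omega\}$ (formula metavariables) be disjoint countably infinite sets of symbols, and $\mathrm{MV}=\mathrm{vrMV}\cup\mathrm{fmMV}$. A language $\mathcal L$ is a set of further symbols (nonlogical predicates) with an arity function $\mathcal L\to\omega$. Fix a language $\mathcal L$. A metaformula is one of: a formula metavariable; $x_i\equiv x_j$; $P(x_{i_1},\dots,x_{i_r})$ with $P\in\mathcal L$ of arity $r$; $\forall x_i\,\Phi$; $\neg\Phi$; $\Phi\to\Psi$, where $\Phi,\Psi$ are metaformulas. $\mathrm{MF}$ is the set of metaformulas. $\mathrm{OC}(\Phi)\subseteq\mathrm{MV}$ is the set of metavariables occurring in $\Phi$ (including those directly after a quantifier), and $\mathrm{OC}(x_i)=\{x_i\}$. For a set $X$, $\mathcal P_2(X)$ is the set of its two-element subsets. **Schemes.** A scheme $\Phi=(\{\Phi_1,\dots,\Phi_n\},\Phi_0,\mathrm{DV}(\Phi))$ consists of a finite set of metaformulas (hypotheses), a metaformula (conclusion), and a set $\mathrm{DV}(\Phi)\subseteq\mathcal P_2(\mathrm{OC}(\Phi))$ (disjoint variable conditions), where $\mathrm{OC}(\Phi)$ is the set of metavariables occurring in its hypotheses or conclusion. Writing $(\Phi_I,\Phi_0,D)$ with a larger $D$ means that $D$ is intersected with $\mathcal P_2(\mathrm{OC}(\Phi))$. Such a scheme is displayed as $\Phi_1\;\&\;\dots\;\&\;\Phi_n\Longrightarrow\Phi_0,\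 \mathrm{DV}(\cdot,\cdot),\dots$, where $\mathrm{DV}(m,n)$ denotes the condition $\{m,n\}$; a scheme without hypotheses is written $(\Phi_0,\mathrm{DV}(\Phi))$. **Substitution and instances.** A substitution is a map $\sigma:\mathrm{MV}\to\mathrm{vrMV}\cup\mathrm{MF}$ with $\sigma(\mathrm{vrMV})\subseteq\mathrm{vrMV}$, $\sigma(\mathrm{fmMV})\subseteq\mathrm{MF}$ and $\sigma(m)=m$ for all but finitely many $m$. $\Phi^\sigma$ is the result of simultaneous plain substitution in the metaformula $\Phi$ (variable metavariables after quantifiers are also replaced). For $D\subseteq\mathcal P_2(\mathrm{MV})$, $D^\sigma=\{\{m,n\}\in\mathcal P_2(\mathrm{MV})\mid\exists\{m',n'\}\in D,\ m\in\mathrm{OC}(\sigma(m')),\ n\in\mathrm{OC}(\sigma(n'))\}$. $\sigma$ is legitimate on a scheme $\Phi$ if $\{m,n\}\in\mathrm{DV}(\Phi)$ implies $\mathrm{OC}(\sigma(m))\cap\mathrm{OC}(\sigma(n))=\varnothing$. A scheme $\Psi$ is an instance of $\Phi$ if for some $\sigma$ legitimate on $\Phi$ the hypotheses and conclusion of $\Psi$ are the images under $\sigma$ of those of $\Phi$ and $\mathrm{DV}(\Phi)^\sigma\subseteq\mathrm{DV}(\Psi)$. **Proofs.** A proof of a scheme $\Phi$ from a set of schemes $S$ is a finite sequence $P$ of metaformulas (lines) whose last line is the conclusion of $\Phi$ and such that each line $P_i$ that is not a hypothesis of $\Phi$ admits $i_1,\dots,i_n<i$ for which $(\{P_{i_1},\dots,P_{i_n}\},P_i,\mathrm{DV}(P))$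 is an instance of a scheme in $S$, where $\mathrm{DV}(P)=\mathrm{DV}(\Phi)\cup\{\{m,n\}\mid m\in\mathrm{OC}(P)\setminus\mathrm{OC}(\Phi),\ n\in\mathrm{OC}(P),\ m\ne n\}$ and $\mathrm{OC}(P)$ is the set of metavariables occurring in the lines of $P$ (or in $\Phi$). $\Phi$ is provable from $S$ if such a proof exists. A scheme is independent in a set of schemes containing it if it is not provable from the other schemes of that set. (Provability does not depend on the choice of the language containing the symbols involved.) **The system $\mathtt{TMM}$.** With $x,y,z$ distinct variable metavariables and $\phi,\psi,\chi,\theta,\tau$ distinct formula metavariables, $\mathtt{TMM}$ is the set of the following schemes: - $\mathtt{mp}$: $\phi\;\&\;\phi\to\psi\Longrightarrow\psi$ - $\mathtt{minimp}$: $\phi\to((\psi\to\chi)\to(((\theta\to\psi)\to(\chi\to\tau))\to(\psi\to\tau)))$ - $\mathtt{peirce}$: $((\phi\to\psi)\to\phi)\to\phi$ - $\mathtt{contrap}$: $(\phi\to\neg\psi)\to(\psi\to\neg\phi)$ - $\mathtt{notelim}$: $\neg\phi\to(\phi\to\psi)$ - $\mathtt{gen}$: $\phi\Longrightarrow\forall x\,\phi$ - $\mathtt{ALLdistr}$: $\forall x(\phi\to\psi)\to(\forall x\,\phi\to\forall x\,\psi)$ - $\mathtt{spec}$: $\forall x\,\phi\to\phi$ - $\mathtt{modal5}$: $\neg\forall x\,\phi\to\forall x\,\neg\forall x\,\phi$ - $\mathtt{vacGen}$: $\phi\to\forall x\,\phi,\ \mathrm{DV}(x,\phi)$ - $\mathtt{ALLcomm}$: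 $\forall x\forall y\,\phi\to\forall y\forall x\,\phi$ - $\mathtt{EQrefl}$: $x\equiv x$ - $\mathtt{EQsymm}$: $x\equiv y\to y\equiv x$ - $\mathtt{EQtrans}$: $x\equiv y\to(y\equiv z\to x\equiv z)$ - $\mathtt{denot}$: $x\equiv x\to\neg\forall y\,\neg\,y\equiv x,\ \mathrm{DV}(x,y)$ - $\mathtt{subst}$: $\forall x(x\equiv y\to(\phi\to\forall x(x\equiv y\to\phi))),\ \mathrm{DV}(x,y),\ \mathrm{DV}(y,\phi)$ - $\mathtt{ALLeq}$: $\forall x\,x\equiv y\to(\forall x\,\phi\to\forall y\,\phi)$ - $\mathtt{genEq}$: $\neg\forall x\,x\equiv y\to(\neg\forall x\,x\equiv z\to(y\equiv z\to\forall x\,y\equiv z))$ *)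

(* Defs.v *)
From Stdlib Require List.
From mathcomp Require Import all_boot.
From mathcomp Require Import mathcomp_extra boolp classical_sets functions.
From mathcomp Require Import cardinality.

Set Implicit Arguments.
Unset Strict Implicit.
Unset Printing Implicit Defensive.

Local Open Scope classical_set_scope.

Inductive metavar := vr of nat | fm of nat.

Definition two_element_subsets (T : Type) (X : set T) : set (set T) :=
  [set d | exists m n, [/\ X m, X n, m <> n & d = [set m; n]]].

Record language := Language { symbol :> Type; arity : symbol -> nat }.

(* Variable metavariables are given by their index: [Eq i j] is x_i == x_j. *)
Inductive metaformula (L : language) :=
| FmVar of nat
| Eq of nat & nat
| Pred (P : L) of (arity P).-tuple nat
| All of nat & metaformula L
| Neg of metaformula L
| Imp of metaformula L & metaformula L.

Arguments FmVar {L}.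
Arguments Eq {L}.

Declare Scope metaformula_scope.
Delimit Scope metaformula_scope with MF.
Bind Scope metaformula_scope with metaformula.
Notation "p ~> q" := (Imp p q)
  (at level 55, right associativity) : metaformula_scope.

Fixpoint OC (L : language) (p : metaformula L) : set metavar :=
  match p with
  | FmVar i => [set fm i]
  | Eq i j => [set vr i; vr j]
  | Pred _ args => [set vr i | i in [set` tval args]]
  | All i q => vr i |` OC q
  | Neg q => OC q
  | Imp q r => OC q `|` OC r
  end.

Definition OC_set (L : language) (A : set (metaformula L)) : set metavar :=
  \bigcup_(p in A) OC p.

Record scheme (L : language) := Scheme {
  hyps : set (metaformula L);
  concl : metaformula L;
  DV : set (set metavar);
  hyps_finite : finite_set hyps;
  DV_sub : DV `<=` two_element_subsets (OC_set (hyps `|` [set concl])) }.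

Definition OC_scheme (L : language) (F : scheme L) : set metavar :=
  OC_set (hyps F `|` [set concl F]).

Definition set_of_list (T : Type) (s : seq T) : set T := [set p | List.In p s].

Lemma set_of_list_finite (T : Type) (s : seq T) : finite_set (set_of_list s).
Proof.
elim: s => [|p s IH]; first exact: finite_set0.
rewrite (_ : set_of_list (p :: s) = [set p] `|` set_of_list s).
  by rewrite finite_setU; split=> //; exact: finite_set1.
by apply/seteqP; split=> q /= [->|]; [left | right | left | right].
Qed.

(* The scheme with hypotheses [hs], conclusion [c] and the disjoint variable
   conditions of [D] that concern metavariables occurring in [hs] or [c]. *)
Definition mk_scheme (L : language) (hs : seq (metaformula L))
    (c : metaformula L) (D : set (set metavar)) : scheme L :=
  @Scheme L (set_of_list hs) c
    (D `&` two_element_subsets (OC_set (set_of_list hs `|` [set c])))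
    (set_of_list_finite hs) (@subIsetr _ _ _).

(* A substitution is presented by its restrictions to the variable and to the
   formula metavariables. *)
Record substitution (L : language) := Substitution {
  on_vr : nat -> nat;
  on_fm : nat -> metaformula L;
  on_vr_finite : finite_set [set i | on_vr i <> i];
  on_fm_finite : finite_set [set i | on_fm i <> FmVar i] }.

Definition OC_image (L : language) (s : substitution L) (m : metavar) :
    set metavar :=
  match m with
  | vr i => [set vr (on_vr s i)]
  | fm i => OC (on_fm s i)
  end.

Fixpoint apply_subst (L : language) (s : substitution L) (p : metaformula L) :
    metaformula L :=
  match p with
  | FmVar i => on_fm s i
  | Eq i j => Eq (on_vr s i) (on_vr s j)
  | Pred P args => Pred (map_tuple (on_vr s) args)
  | All i q => All (on_vr s i) (apply_subst s q)
  | Neg q => Neg (apply_subst s q)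
  | Imp q r => Imp (apply_subst s q) (apply_subst s r)
  end.

Definition DV_subst (L : language) (s : substitution L)
    (D : set (set metavar)) : set (set metavar) :=
  [set d | two_element_subsets setT d /\
    exists m n m' n', [/\ d = [set m; n], D [set m'; n'],
                          OC_image s m' m & OC_image s n' n]].

Definition legitimate (L : language) (s : substitution L) (F : scheme L) :=
  forall m n, DV F [set m; n] -> OC_image s m `&` OC_image s n = set0.

Definition instance_of (L : language) (F G : scheme L) :=
  exists s : substitution L,
    [/\ legitimate s F,
        hyps G = apply_subst s @` hyps F,
        concl G = apply_subst s (concl F)
      & DV_subst s (DV F) `<=` DV G].

Definition OC_proof (L : language) (F : scheme L) (P : seq (metaformula L)) :
    set metavar :=
  OC_set (set_of_list P) `|` OC_scheme F.

Definition DV_proof (L : language) (F : scheme L) (P : seq (metaformula L)) :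
    set (set metavar) :=
  DV F `|` [set d | exists m n,
    [/\ (OC_proof F P `\` OC_scheme F) m, OC_proof F P n, m <> n
      & d = [set m; n]]].

Definition is_proof (L : language) (S : set (scheme L)) (F : scheme L)
    (P : seq (metaformula L)) :=
  let line i := nth (concl F) P i in
  (exists Q, P = rcons Q (concl F)) /\
  forall i, i < size P -> ~ hyps F (line i) ->
    exists js : seq nat,
      (forall j, j \in js -> j < i) /\
      exists2 G, S G
        & instance_of G (mk_scheme (map line js) (line i) (DV_proof F P)).

Definition provable (L : language) (S : set (scheme L)) (F : scheme L) :=
  exists P, is_proof S F P.

Definition independent (L : language) (S : set (scheme L)) (F : scheme L) :=
  S F /\ ~ provable (S `\ F) F.

Section TMM.
Variable L : language.
Local Open Scope metaformula_scope.

Definition x := 0.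
Definition y := 1.
Definition z := 2.
Definition phi := 0.
Definition psi := 1.
Definition chi := 2.
Definition theta := 3.
Definition tau := 4.

Local Notation ph := (@FmVar L phi).
Local Notation ps := (@FmVar L psi).
Local Notation ch := (@FmVar L chi).
Local Notation th := (@FmVar L theta).
Local Notation ta := (@FmVar L tau).
Local Notation EQ := (@Eq L).

Definition mp := mk_scheme [:: ph; ph ~> ps] ps set0.
Definition minimp := mk_scheme [::]
  (ph ~> ((ps ~> ch) ~> (((th ~> ps) ~> (ch ~> ta)) ~> (ps ~> ta)))) set0.
Definition peirce := mk_scheme [::] (((ph ~> ps) ~> ph) ~> ph) set0.
Definition contrap := mk_scheme [::] ((ph ~> Neg ps) ~> (ps ~> Neg ph)) set0.
Definition notelim := mk_scheme [::] (Neg ph ~> (ph ~> ps)) set0.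
Definition gen := mk_scheme [:: ph] (All x ph) set0.
Definition ALLdistr := mk_scheme [::]
  (All x (ph ~> ps) ~> (All x ph ~> All x ps)) set0.
Definition spec := mk_scheme [::] (All x ph ~> ph) set0.
Definition modal5 := mk_scheme [::]
  (Neg (All x ph) ~> All x (Neg (All x ph))) set0.
Definition vacGen := mk_scheme [::] (ph ~> All x ph) [set [set vr x; fm phi]].

Definition ALLcomm_DV (D : set (set metavar)) := mk_scheme [::]
  (All x (All y ph) ~> All y (All x ph)) D.
Definition ALLcomm := ALLcomm_DV set0.

Definition EQrefl := mk_scheme [::] (EQ x x) set0.
Definition EQsymm := mk_scheme [::] (EQ x y ~> EQ y x) set0.
Definition EQtrans := mk_scheme [::]
  (EQ x y ~> (EQ y z ~> EQ x z)) set0.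
Definition denot := mk_scheme [::]
  (EQ x x ~> Neg (All y (Neg (EQ y x))))
  [set [set vr x; vr y]].
Definition subst := mk_scheme [::]
  (All x (EQ x y ~> (ph ~> All x (EQ x y ~> ph))))
  [set [set vr x; vr y]; [set vr y; fm phi]].
Definition ALLeq := mk_scheme [::]
  (All x (EQ x y) ~> (All x ph ~> All y ph)) set0.
Definition genEq := mk_scheme [::]
  (Neg (All x (EQ x y)) ~>
    (Neg (All x (EQ x z)) ~> (EQ y z ~> All x (EQ y z)))) set0.

Definition TMM : set (scheme L) := set_of_list
  [:: mp; minimp; peirce; contrap; notelim; gen; ALLdistr; spec; modal5;
      vacGen; ALLcomm; EQrefl; EQsymm; EQtrans; denot; subst; ALLeq; genEq].

End TMM.

Arguments TMM L : clear implicits.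

(* Main.v *)
(** Read the formulas over two-valued assignments, with standard quantifiers,
  except that quantifying over [y] moves [x] along with [y]: [All y p] says that
  [p] holds whenever [x] and [y] receive the same arbitrary value.  A proof of
  [ALLcomm] has no disjoint variable condition among [x], [y] and [phi], so no
  step of it can tell that [y] moves [x], and every available scheme stays
  sound; [spec] and [ALLeq] would not.  Reading [phi] as [x = y] makes
  [All x (All y phi)] true and [All y (All x phi)] false. *)

Require Import Defs.
From mathcomp Require Import all_boot.
From mathcomp Require Import mathcomp_extra boolp classical_sets.

Set Implicit Arguments.
Unset Strict Implicit.

Local Open Scope classical_set_scope.

(** * Semantics with coupled updates *)

Definition assignment := nat -> bool.

Definition upd (i : nat) (b : bool) (s : assignment) : assignment :=
  fun j => if (j == i) || (i == y) && (j == x) then b else s j.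

(** Only [phi] has to carry the counterexample, so predicates and the other formula metavariables
    are read as true. *)
Fixpoint eval (L : language) (p : metaformula L) (s : assignment) : bool :=
  match p with
  | FmVar i => (i == phi) ==> (s x == s y)
  | Eq i j => s i == s j
  | Pred _ _ => true
  | All i q => eval q (upd i true s) && eval q (upd i false s)
  | Neg q => ~~ eval q s
  | Imp q r => eval q s ==> eval r s
  end.

Definition valid (L : language) (p : metaformula L) := forall s, eval p s.

(** These are the metavariables that do not occur in [ALLcomm], since [x], [y] and [phi] have
    indices 0, 1 and 0. *)
Definition fresh (m : metavar) : bool :=
  match m with vr i => y < i | fm i => phi < i end.

(* All disjoint variable conditions of a proof of [ALLcomm] are pairs [{m, n}]
   with [apart m n]. *)
Definition apart (m n : metavar) : Prop := m <> n /\ (fresh m || fresh n).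

Lemma eval_all (L : language) i (p : metaformula L) s :
  reflect (forall b, eval p (upd i b s)) (eval (All i p) s).
Proof.
apply: (iffP andP) => [[pt pf] [] //|H]; by split; apply: H.
Qed.

Lemma eval_imp (L : language) (p q : metaformula L) s :
  reflect (eval p s -> eval q s) (eval (Imp p q) s).
Proof. exact: implyP. Qed.

Lemma eval_neg (L : language) (p : metaformula L) s :
  reflect (~ eval p s) (eval (Neg p) s).
Proof. exact: negP. Qed.

(** * Updates and the coincidence lemma *)

Lemma upd_same i b s : upd i b s i = b.
Proof. by rewrite /upd eqxx. Qed.

Lemma upd_twice i b c s : upd i b (upd i c s) =1 upd i b s.
Proof. by move=> j; rewrite /upd; case: (_ || _). Qed.

(** Besides [i] itself, an update at [i] can move only [x], and only when [i] is [y]; neither of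
    these two is fresh. *)
Lemma upd_apart i j b s : apart (vr i) (vr j) -> upd i b s j = s j.
Proof.
rewrite /upd /x /y => -[ij] /= f; case: ifP => // /orP[/eqP e|].
  by case: ij; rewrite e.
by case/andP=> /eqP e1 /eqP e2; move: f; rewrite e1 e2.
Qed.

Lemma updC i j b c s : apart (vr i) (vr j) ->
  upd i b (upd j c s) =1 upd j c (upd i b s).
Proof.
move=> [ij] /=; rewrite /upd /x /y => f k.
have {}ij : i != j by apply/eqP => e; apply: ij; rewrite e.
case: (eqVneq k i) => [ki|ki] /=; case: (eqVneq k j) => [kj|kj] /=.
- by rewrite -ki -kj eqxx in ij.
(* It only matters whether each index is [x], [y] or larger. *)
all: by move: i j k ij f ki kj => [|[|i]] [|[|j]] [|[|k]].
Qed.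

(** The second clause is there because [phi] is evaluated at [x] and [y] although neither occurs in
    it. *)
Definition agree (L : language) (p : metaformula L) (s t : assignment) :=
  (forall k, OC p (vr k) -> s k = t k) /\
  (OC p (fm phi) -> s x = t x /\ s y = t y).

Lemma agree_upd (L : language) (p : metaformula L) i b s t :
  agree p s t -> agree p (upd i b s) (upd i b t).
Proof.
move=> [H1 H2]; split=> [k /H1|/H2 []]; rewrite /upd; first by case: (_ || _).
by move=> e1 e2; split; case: (_ || _).
Qed.

(** If [phi] occurs in [p], apartness forces [vr i] to be fresh, as [phi] is not; the update then
    moves neither [x] nor [y]. *)
Lemma agree_apart (L : language) (p : metaformula L) i b s :
  (forall m, OC p m -> apart (vr i) m) -> agree p (upd i b s) s.
Proof.
move=> H; split=> [k /H /upd_apart //|/H [_]].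
by rewrite /upd /x /y; case: i {H} => [|[|i]].
Qed.

Lemma eval_agree (L : language) (p : metaformula L) s t :
  agree p s t -> eval p s = eval p t.
Proof.
elim: p s t => [i|i j|P a|i q IH|q IH|q IHq r IHr] s t //= [H1 H2].
- by case: eqP H2 => // -> H2; have [-> ->] := H2 erefl.
- by rewrite !H1 //; [right|left].
- have qst : agree q s t by split=> [k qk|qf]; [apply: H1|apply: H2]; right.
  by congr (_ && _); apply: IH; apply: agree_upd.
- by rewrite (IH s t).
- congr (_ ==> _); [apply: IHq|apply: IHr]; split=> [k qk|qf];
    [apply: H1|apply: H2|apply: H1|apply: H2]; by [left|right].
Qed.

Lemma eq_eval (L : language) (p : metaformula L) s t :
  s =1 t -> eval p s = eval p t.
Proof. by move=> st; apply: eval_agree; split=> *; rewrite !st. Qed.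

(** * Validity of the axioms under apartness *)

Section Validities.
Variable L : language.
Implicit Types p q : metaformula L.
Local Open Scope metaformula_scope.

Lemma valid_ALLdistr i p q : valid (All i (p ~> q) ~> (All i p ~> All i q)).
Proof.
move=> s; apply/eval_imp => /eval_all pq; apply/eval_imp => /eval_all pp.
by apply/eval_all => b; exact: (eval_imp _ _ _ (pq b)).
Qed.

Lemma valid_modal5 i p : valid (Neg (All i p) ~> All i (Neg (All i p))).
Proof.
move=> s; apply/eval_imp => /eval_neg np; apply/eval_all => b.
apply/eval_neg => /eval_all pp; apply: np; apply/eval_all => c.
by rewrite -(eq_eval _ (upd_twice i c b s)).
Qed.

Lemma valid_vacGen i p :
  (forall m, OC p m -> apart (vr i) m) -> valid (p ~> All i p).
Proof.
move=> ip s; apply/eval_imp => ps; apply/eval_all => b.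
by rewrite (eval_agree (agree_apart _ _ ip)).
Qed.

Lemma valid_ALLcomm_vars i j p :
  apart (vr i) (vr j) -> valid (All i (All j p) ~> All j (All i p)).
Proof.
move=> ij s; apply/eval_imp => /eval_all H.
apply/eval_all => c; apply/eval_all => b.
by rewrite (eq_eval _ (updC _ _ _ ij)); move/eval_all: (H b).
Qed.

(** The updates need not commute here, but those at [j] do not affect [p], so both sides quantify
    [p] over [i] alone. *)
Lemma valid_ALLcomm_body i j p : (forall m, OC p m -> apart (vr j) m) ->
  valid (All i (All j p) ~> All j (All i p)).
Proof.
move=> jp s; apply/eval_imp => /eval_all H.
apply/eval_all => c; apply/eval_all => b.
have e t d : eval p (upd j d t) = eval p t.
  by apply: eval_agree; exact: agree_apart.
have -> : eval p (upd i b (upd j c s)) = eval p (upd i b s).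
  by apply: eval_agree; apply: agree_upd; exact: agree_apart.
by rewrite -(e _ c); move/eval_all: (H b).
Qed.

Lemma valid_EQtrans i j k : valid (@Eq L i j ~> (Eq j k ~> Eq i k)).
Proof. by move=> s /=; apply/implyP => /eqP ->; exact: implybb. Qed.

Lemma valid_denot i j : apart (vr i) (vr j) ->
  valid (@Eq L i i ~> Neg (All j (Neg (Eq j i)))).
Proof.
(* The witness for [j] is the value of [i], which the update at [j] leaves in place. *)
move=> [ij f] s; apply/eval_imp => _; apply/eval_neg => /eval_all /(_ (s i)) /=.
by rewrite upd_same upd_apart ?eqxx //; split; [exact: nesym|rewrite orbC].
Qed.

(** Updates at [i] do not move [j], so both equations force the value [s j] on [i], and both copies
    of [p] are evaluated at the same assignment. *)
Lemma valid_subst i j p : apart (vr i) (vr j) ->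
  valid (All i (Eq i j ~> (p ~> All i (Eq i j ~> p)))).
Proof.
move=> ij s; apply/eval_all => b; apply/eval_imp => /=.
rewrite upd_same upd_apart // => /eqP ->.
apply/implyP => ps; apply/(eval_all i (Eq i j ~> p)) => c /=.
rewrite upd_same !upd_apart //; apply/implyP => /eqP ->.
by rewrite (eq_eval _ (upd_twice _ _ _ _)).
Qed.

Lemma valid_genEq i j k : valid (Neg (All i (@Eq L i j)) ~>
  (Neg (All i (Eq i k)) ~> (Eq j k ~> All i (Eq j k)))).
Proof.
(* An update at [i] either carries [l] along, making the two always equal, or leaves [l] alone. The
   premises exclude the first case for [j] and [k]. *)
have upd_or l s : eval (All i (@Eq L i l)) s \/ forall b, upd i b s l = s l.
  have [li|li] := boolP ((l == i) || (i == y) && (l == x)); [left|right].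
    by apply/eval_all => b /=; rewrite upd_same /upd li.
  by move=> b; rewrite /upd (negbTE li).
move=> s; apply/eval_imp => /eval_neg nj; apply/eval_imp => /eval_neg nk.
apply/eval_imp => /= jk; apply/(eval_all i (@Eq L j k)) => b /=.
by have [//|->] := upd_or j s; have [//|->] := upd_or k s.
Qed.

Lemma not_valid_ALLcomm : ~ valid (concl (ALLcomm L)).
(* Any assignment would do, since the quantifiers overwrite both [x] and [y]. *)
Proof. by move=> /(_ xpredT). Qed.

(** * Soundness along proofs of [ALLcomm] *)

Definition respects (s : substitution L) (G : scheme L) :=
  forall m n m' n', DV G [set m; n] ->
    OC_image s m m' -> OC_image s n n' -> apart m' n'.

(** Soundness is asked only for substitutions that can occur in a proof of [ALLcomm], and it
    preserves validity, not truth at one assignment, as [gen] demands. *)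
Definition sound (G : scheme L) := forall s, respects s G ->
  (forall p, hyps G p -> valid (apply_subst s p)) ->
  valid (apply_subst s (concl G)).

Lemma fresh_notin m : ~ OC_scheme (ALLcomm L) m -> fresh m.
Proof.
move=> nm; apply/negP => fm_; apply: nm.
exists (concl (ALLcomm L)); first by right.
case: m fm_ => [[|[|i]]|[|i]] //= _.
- by left; left.
- by left; right; left.
- by left; right; right.
Qed.

(** [ALLcomm] contributes no condition, so each pair contains a metavariable foreign to it, hence
    fresh. *)
Lemma DV_proof_apart P m n :
  m <> n -> DV_proof (ALLcomm L) P [set m; n] -> apart m n.
Proof.
move=> mn [[[]]|[m' [n' [[_ /fresh_notin fm'] _ _ e]]]]; split=> //.
have [<-|<-] : [set m; n] m' by rewrite e; left.
  by rewrite fm'.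
by rewrite fm' orbT.
Qed.

Lemma In_map (T : eqType) (U : Type) (f : T -> U) (ts : seq T) u :
  List.In u (map f ts) -> exists2 t, t \in ts & u = f t.
Proof.
elim: ts => //= t ts IH [<-|/IH[t' t'ts ->]].
  by exists t => //; exact: mem_head.
by exists t' => //; rewrite inE t'ts orbT.
Qed.

Lemma soundness (S : set (scheme L)) :
  (forall G, S G -> sound G) -> ~ provable S (ALLcomm L).
Proof.
move=> Ssound [P [[Q PE] HP]]; apply: not_valid_ALLcomm.
suff H i : i < size P -> valid (nth (concl (ALLcomm L)) P i).
  have := H (size Q); rewrite PE nth_rcons ltnn eqxx; apply.
  by rewrite size_rcons.
elim/ltn_ind: i => i IH iP.
(* [ALLcomm] has no hypotheses, so every line is the conclusion of an instance. *)
have [|js [jsi [G SG [s [leg hE cE DVs]]]]] := HP i iP; first by case.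
rewrite /= in cE; rewrite cE; apply: (Ssound G SG s) => [m n m' n' Gmn sm sn|p Gp].
  (* Legitimacy supplies the distinctness that [DV_subst] requires of its pairs. *)
  have m'n' : m' <> n'.
    move=> e; have := leg m n Gmn; rewrite -subset0 => /(_ m'); apply.
    by split=> //; rewrite e.
  apply: (DV_proof_apart (P := P)) => //.
  suff /DVs[] : DV_subst s (DV G) [set m'; n'] by [].
  by split; [exists m', n'|exists m', n', m, n].
have : (apply_subst s @` hyps G) (apply_subst s p) by exists p.
rewrite -hE => /= pjs; have [j jjs ->] := In_map pjs.
by apply: IH (jsi j jjs) (ltn_trans (jsi j jjs) iP).
Qed.

Lemma sound_nil c D :
  (forall s, respects s (@mk_scheme L [::] c D) -> valid (apply_subst s c)) ->
  sound (mk_scheme [::] c D).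
Proof. by move=> H s /H. Qed.

(** Conditions on metavariables of the conclusion survive the intersection made by [mk_scheme]. *)
Lemma mk_scheme_DV (hs : seq (metaformula L)) c (D : set (set metavar)) m n :
  D [set m; n] -> m <> n -> OC c m -> OC c n ->
  DV (mk_scheme hs c D) [set m; n].
Proof.
move=> Dmn mn cm cn; split=> //; exists m, n; split=> //.
- by exists c => //; right.
- by exists c => //; right.
Qed.

Lemma sound_ALLcomm_DV D :
  [set [set vr x; vr y]; [set vr y; fm phi]] D ->
  sound (ALLcomm_DV L [set D]).
Proof.
case=> ->; apply: sound_nil => s rs /=.
  apply: valid_ALLcomm_vars; apply: (rs (vr x) (vr y)) => //.
  apply: mk_scheme_DV => //; first by left; left.
  by left; right; left.
apply: valid_ALLcomm_body => m sm; apply: (rs (vr y) (fm phi)) => //.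
apply: mk_scheme_DV => //; first by left; right; left.
by left; right; right.
Qed.

Lemma sound_TMM G :
  (TMM L `\` [set spec L; ALLeq L; ALLcomm L]) G -> sound G.
Proof.
case=> /= + nG.
(* The cases follow the order of the list in [TMM]; the excluded schemes contradict [nG], and the
   propositional axioms are checked by truth tables. *)
case=> [<-|]; first by move=> s _ H t;
  exact: (eval_imp _ _ _ (H _ (or_intror (or_introl erefl)) t)
    (H _ (or_introl erefl) t)).
case=> [<-|]; first by apply: sound_nil => s _ t /=; do !case: (eval _ t).
case=> [<-|]; first by apply: sound_nil => s _ t /=; do !case: (eval _ t).
case=> [<-|]; first by apply: sound_nil => s _ t /=; do !case: (eval _ t).
case=> [<-|]; first by apply: sound_nil => s _ t /=; do !case: (eval _ t).
case=> [<-|]; first by move=> s _ H t; apply/eval_all => b;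
  exact: (H _ (or_introl erefl)).
case=> [<-|]; first by apply: sound_nil => s _; exact: valid_ALLdistr.
case=> [e|]; first by case: nG; left; left.
case=> [<-|]; first by apply: sound_nil => s _; exact: valid_modal5.
case=> [<-|].
  apply: sound_nil => s rs; apply: valid_vacGen => m sm.
  apply: (rs (vr x) (fm phi)) => //.
  by apply: mk_scheme_DV => //; [right; left|left].
case=> [e|]; first by case: nG; right.
case=> [<-|]; first by apply: sound_nil => s _ t /=; exact: eqxx.
case=> [<-|]; first by apply: sound_nil => s _ t /=; rewrite eq_sym implybb.
case=> [<-|]; first by apply: sound_nil => s _; exact: valid_EQtrans.
case=> [<-|].
  apply: sound_nil => s rs; apply: valid_denot; apply: (rs (vr x) (vr y)) => //.
  by apply: mk_scheme_DV => //; [left; left|right; left].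
case=> [<-|].
  apply: sound_nil => s rs; apply: valid_subst; apply: (rs (vr x) (vr y)) => //.
  by apply: mk_scheme_DV => //; [left|left|right; left; right].
case=> [e|]; first by case: nG; left; right.
by case=> [<-|//]; apply: sound_nil => s _; exact: valid_genEq.
Qed.

End Validities.

Theorem proposition3p9 (L : language) :
  (forall D : set metavar,
     [set [set vr x; vr y]; [set vr y; fm phi]] D ->
     ~ provable
         ((TMM L `\` [set spec L; ALLeq L; ALLcomm L])
            `|` [set ALLcomm_DV L [set D]])
         (ALLcomm L)) /\
  independent (TMM L `\` [set spec L; ALLeq L]) (ALLcomm L).
Proof.
split=> [D HD|]; first by apply: soundness => G [/sound_TMM //|->];
  exact: sound_ALLcomm_DV.
split.
  (* [ALLcomm] is the eleventh scheme of the list, and its conclusion differs from those of [spec]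
     and [ALLeq]. *)
  split; first by rewrite /TMM /set_of_list /=; do 10 right; left.
  by case=> /(congr1 (@concl L)).
apply: soundness => G [[TG nG] nC]; apply: sound_TMM; split=> //.
by case.
Qed.
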